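(* For every integer $n\geq 0$, \[ \sum_{k=0}^{n}(k+1)Q_{n,k} = M_{n+2}-I_{n+2}+(n+2)I_{n+1},\qquad \sum_{k=0}^{n}(n-k+1)Q_{n,k}= I_{n+2}-(n+2)M_{n+1}-M_{n+2}. \]
   Context: An involution of a finite set is a permutation $\sigma$ with $\sigma^2=\mathrm{id}$. For $0\le k\le n$, $Q_{n,k}$ is the number of involutions of $[n+1]=\{1,\dots,n+1\}$ whose largest fixed point is $k+1$. $I_n$ is the number of involutions of $[n]$, and $M_n$ is the number of fixed-point-free involutions of $[n]$. *)

(* Defs.v *)
From mathcomp Require Import all_boot all_order all_algebra all_fingroup.

Set Implicit Arguments.
Unset Strict Implicit.
Unset Printing Implicit Defensive.

(* The set [n] = {1, ..., n} is represented by 'I_n, the ordinal i standing   *)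
(* for the element i + 1.                                                     *)

(* The identity counts as an involution. *)
Definition is_involution (n : nat) (s : 'S_n) : bool := (s ^+ 2 == 1)%g.

Definition largest_fixpoint (n : nat) (s : 'S_n) (i : 'I_n) : bool :=
  (s i == i) && [forall j : 'I_n, (s j == j) ==> (j <= i)].

Definition numI (n : nat) : nat := #|[set s : 'S_n | is_involution s]|.

Definition numM (n : nat) : nat :=
  #|[set s : 'S_n | is_involution s && [forall i : 'I_n, s i != i]]|.

(* The index k : 'I_n.+1 encodes 0 <= k <= n; as an element of [n + 1] it     *)
(* stands for k + 1.                                                          *)
Definition numQ (n : nat) (k : 'I_n.+1) : nat :=
  #|[set s : 'S_n.+1 | is_involution s && largest_fixpoint s k]|.

(* Main.v *)
(* Insert a new fixed point q into an involution t of [n + 1] all of whose     *)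
(* fixed points lie before q. This produces each involution of [n + 2] with a  *)
(* fixed point exactly once, q being its largest fixed point, so that          *)
(* I_(n+2) - M_(n+2) counts the pairs (t, q). A given t admits n + 2 positions *)
(* q if it has no fixed point, and n + 1 - k if its largest one is k + 1. This *)
(* is the second identity. The two left-hand sides add up to                   *)
(* (n + 2) (I_(n+1) - M_(n+1)), which yields the first one.                    *)
Require Import Defs.
From mathcomp Require Import all_boot all_order all_algebra all_fingroup.
From mathcomp Require Import zify ring.
Import GRing.Theory.

(** Insertion of a fixed point [q] is [lift_perm q q]: injective, onto the permutations fixing [q],
    and compatible with being an involution. Hence [numQ_lift] expresses [numQ q] through
    permutations of one point fewer. The double count is [numI_insert], where [sum_involutions]
    sorts the smaller involutions by their largest fixed point; [numI_split] supplies the total of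
    the [numQ k] for the first identity. *)

Lemma lift_perm_fixpointP (n : nat) (q : 'I_n.+1) (s : 'S_n.+1) :
  reflect (exists t : 'S_n, s = lift_perm q q t) (s q == q).
Proof.
apply: (iffP eqP) => [sq|[t ->]]; last exact: lift_perm_id.
(* Being injective and fixing [q], [s] maps the complement of [q] to itself; read through [lift q],
   this restriction is the required [t]. *)
have liftE i : {j | s (lift q i) = lift q j}.
  have ne : q != s (lift q i).
    by rewrite -{1}sq (inj_eq perm_inj) neq_lift.
  by case: (unlift_some ne) => j ->; exists j.
pose f i := sval (liftE i).
have fE i : s (lift q i) = lift q (f i) by rewrite /f; case: (liftE i).
have f_inj : injective f.
  move=> i j eq_f; apply: (@lift_inj _ q); apply: (@perm_inj _ s).
  by rewrite !fE eq_f.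
exists (perm f_inj); apply/permP => i.
case: (unliftP q i) => [j|] ->; last by rewrite lift_perm_id.
by rewrite lift_perm_lift permE.
Qed.

Lemma lift_perm_inj (n : nat) (q : 'I_n.+1) : injective (@lift_perm n q q).
Proof.
move=> s t eq_st; apply/permP => i; apply: (@lift_inj _ q).
by rewrite -!(lift_perm_lift q q) eq_st.
Qed.

Lemma is_involution_lift (n : nat) (q : 'I_n.+1) (t : 'S_n) :
  is_involution (lift_perm q q t) = is_involution t.
Proof.
rewrite /is_involution !expgS !expg0 !mulg1 lift_permM -(lift_perm1 q).
exact: inj_eq (@lift_perm_inj n q) _ _.
Qed.

(** [lift q] keeps indices below [q] and raises the others by one. An old fixed point with index [q]
    would land after the new one, hence the strict bound. *)
Lemma largest_fixpoint_lift (n : nat) (q : 'I_n.+1) (t : 'S_n) :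
  largest_fixpoint (lift_perm q q t) q
    = [forall j : 'I_n, (t j == j) ==> (j < q)].
Proof.
rewrite /largest_fixpoint lift_perm_id eqxx.
apply/forallP/forallP => H j; apply/implyP => fj.
  have := H (lift q j); rewrite lift_perm_lift (eqP fj) eqxx /= /bump.
  by lia.
case: (unliftP q j) fj => [i|] -> //.
rewrite lift_perm_lift (inj_eq (@lift_inj _ q)) => fi.
by have := H i; rewrite fi /= /bump; lia.
Qed.

Lemma numQ_lift (n : nat) (q : 'I_n.+1) :
  numQ q = #|[set t : 'S_n | is_involution t
                & [forall j : 'I_n, (t j == j) ==> (j < q)]]|.
Proof.
rewrite /numQ -(card_imset _ (@lift_perm_inj n q)).
apply: eq_card => s; rewrite inE; apply/andP/imsetP => [[inv_s max_s]|[t]].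
  have /andP[/lift_perm_fixpointP[t st] _] := max_s.
  exists t => //; move: inv_s max_s.
  by rewrite st is_involution_lift largest_fixpoint_lift inE => -> ->.
by rewrite inE => ? ->; rewrite is_involution_lift largest_fixpoint_lift; apply/andP.
Qed.

(** A permutation either has no fixed point or has exactly one largest one, so the weight [c] is
    counted once on the right. *)
Lemma sum_largest_fixpoint (n : nat) (s : 'S_n) (c : nat) :
  c = [forall i : 'I_n, s i != i] * c + \sum_(k | largest_fixpoint s k) c.
Proof.
case: (boolP [forall i, _]) => [/forallP nofix | /forallPn[i0]].
  by rewrite mul1n big_pred0 ?addn0 // => k; rewrite /largest_fixpoint (negPf (nofix k)).
rewrite negbK mul0n add0n => fix_i0.
case: (@arg_maxnP _ i0 (fun i => s i == i) (@nat_of_ord n) fix_i0) => k fix_k max_k.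
rewrite (big_pred1 k) // => j; rewrite /largest_fixpoint.
apply/andP/eqP => [[fix_j /forallP max_j] | ->].
  apply: val_inj; apply/eqP; rewrite eqn_leq [val j <= _]max_k //=.
  by have /implyP -> := max_j k.
by split=> //; apply/forallP => i; apply/implyP => /max_k.
Qed.

Lemma sum_involutions (n : nat) (F : 'S_n.+1 -> nat) :
  \sum_(s | is_involution s) F s
    = \sum_(s | is_involution s && [forall i, s i != i]) F s
      + \sum_(k < n.+1) \sum_(s | is_involution s && largest_fixpoint s k) F s.
Proof.
rewrite [X in _ + X](exchange_big_dep (@is_involution n.+1)) /=; last first.
  by move=> k s _ /andP[].
rewrite big_mkcondr -big_split /=; apply: eq_bigr => s inv_s.
rewrite {1}(sum_largest_fixpoint _ s (F s)) inv_s /=.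
by case: ifP; rewrite ?mul1n ?mul0n.
Qed.

Lemma numI_split (n : nat) : numI n.+1 = numM n.+1 + \sum_(k < n.+1) numQ k.
Proof.
rewrite /numI /numM cardsE -sum1_card sum_involutions; congr (_ + _).
  by rewrite cardsE -sum1_card.
by apply: eq_bigr => k _; rewrite /numQ cardsE -sum1_card.
Qed.

Lemma card_ord_gt (n k : nat) : #|[set q : 'I_n | k < q]| = n - k.+1.
Proof.
by rewrite cardsE -sum1_card -(big_geq_mkord _ _ xpredT (fun=> 1)) sum_nat_const_nat muln1.
Qed.

Lemma numI_insert (n : nat) :
  numI n.+2 = numM n.+2 + n.+2 * numM n.+1
              + \sum_(k < n.+1) (n.+1 - k) * numQ k.
Proof.
rewrite numI_split -addnA; congr (_ + _).
pose P (t : 'S_n.+1) (q : 'I_n.+2) :=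
  [forall j : 'I_n.+1, (t j == j) ==> (j < q)].
(* Swap the order of summation over the pairs [(t, q)]. *)
transitivity (\sum_(t : 'S_n.+1 | is_involution t) #|[set q | P t q]|).
  under eq_bigr => q _ do rewrite numQ_lift cardsE -sum1_card.
  rewrite (exchange_big_dep (@is_involution n.+1)) /=; last first.
    by move=> q t _; case/andP.
  apply: eq_bigr => t inv_t; rewrite cardsE -sum1_card.
  by apply: eq_bigl => q; rewrite [in LHS]unfold_in inv_t.
rewrite sum_involutions; congr (_ + _).
  (* Without fixed points [P t q] is vacuous: all [n.+2] positions are open. *)
  rewrite /numM cardsE mulnC -sum_nat_const; apply: eq_bigr => t /andP[_ /forallP nofix].
  rewrite -[RHS]card_ord -cardsT; congr #|pred_of_set _|.
  apply/setP => q; rewrite !inE; apply/forallP => j.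
  by rewrite (negPf (nofix j)).
apply: eq_bigr => k _; rewrite /numQ cardsE mulnC -sum_nat_const.
apply: eq_bigr => t /andP[_ /andP[fix_k /forallP max_k]].
(* With largest fixed point [k], the open positions are the [q > k] in ['I_n.+2]. *)
rewrite -[n.+1 - k]/(n.+2 - k.+1) -card_ord_gt; congr #|pred_of_set _|.
apply/setP => q; rewrite !inE; apply/forallP/idP => [/(_ k)|k_lt_q j].
  by rewrite fix_k.
by apply/implyP => fix_j; apply: leq_ltn_trans k_lt_q; have /implyP -> := max_k j.
Qed.

Local Open Scope ring_scope.

Theorem theorem4p5 (n : nat) :
  \sum_(k < n.+1) (k%:Z + 1) * (numQ k)%:Z
    = (numM n.+2)%:Z - (numI n.+2)%:Z + (n%:Z + 2) * (numI n.+1)%:Z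
  /\
  \sum_(k < n.+1) (n%:Z - k%:Z + 1) * (numQ k)%:Z
    = (numI n.+2)%:Z - (n%:Z + 2) * (numM n.+1)%:Z - (numM n.+2)%:Z.
Proof.
have second : \sum_(k < n.+1) (n%:Z - k%:Z + 1) * (numQ k)%:Z
    = (numI n.+2)%:Z - (n%:Z + 2) * (numM n.+1)%:Z - (numM n.+2)%:Z.
  have -> : \sum_(k < n.+1) (n%:Z - k%:Z + 1) * (numQ k)%:Z
      = (\sum_(k < n.+1) (n.+1 - k) * numQ k)%N%:Z.
    (* The truncated [n.+1 - k] agrees with the integer weight because [k < n.+1]. *)
    rewrite -[RHS]natz natr_sum; apply: eq_bigr => k _.
    by rewrite natz PoszM; congr (_ * _); have := ltn_ord k; lia.
  by rewrite numI_insert; lia.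
split=> //.
(* The two weights of each [numQ k] add up to [n + 2], independently of [k]. *)
have total : \sum_(k < n.+1) (k%:Z + 1) * (numQ k)%:Z
    + \sum_(k < n.+1) (n%:Z - k%:Z + 1) * (numQ k)%:Z
    = (n%:Z + 2) * (\sum_(k < n.+1) numQ k)%N%:Z.
  rewrite -[X in _ * X]natz natr_sum mulr_sumr -big_split /=.
  by apply: eq_bigr => k _; rewrite natz; ring.
move: total; rewrite second (numI_split n); lia.
Qed.
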